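(* There exist problem-independent constants $C, C_1, C_2>0$ such that the following holds. Suppose that $\epsilon,\delta\in(0,1)$, $r\le d\le n$ and $m\le n$ are positive integers, and $E>0$ satisfy $$C\le E\le \frac{2e^{4r}}{[4r+\log(1/\delta)]\,\delta},\qquad m\ge E\,C_2^{-2}\epsilon^{-2}\,[4r+\log(1/\delta)].$$ Then for any matrix $A\in\mathbb{R}^{n\times d}$ with rank $r$ and coherence $\mu(A)\le\bar\mu(\epsilon,\delta)$, where $$\bar\mu(\epsilon,\delta)=C_1\sqrt{C_2}\sqrt{\epsilon}\,\min\left\{\frac{\log(E/(C_2\epsilon))}{4r+\log(1/\delta)},\ \sqrt{\frac{\log E}{4r+\log(1/\delta)}}\right\},$$ a randomly generated 1-hashing matrix $S\in\mathbb{R}^{m\times n}$ is an $\epsilon$-subspace embedding for $A$ with probability at least $1-\delta$.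
   Context: Coherence: if $A=U\Sigma V^T$ is the compact SVD of a rank-$r$ matrix $A\in\mathbb{R}^{n\times d}$ ($U\in\mathbb{R}^{n\times r}$, $V\in\mathbb{R}^{d\times r}$ with orthonormal columns, $\Sigma\in\mathbb{R}^{r\times r}$ diagonal with strictly positive diagonal), then $\mu(A)=\max_{1\le i\le n}\|U_i\|_2$, where $U_i$ is the $i$-th row of $U$. 1-hashing matrix: a random matrix $S\in\mathbb{R}^{m\times n}$ such that, independently for each column $j\in\{1,\dots,n\}$, a row index $i\in\{1,\dots,m\}$ is sampled uniformly at random and $S_{ij}=\pm1$ with equal probability; all other entries of column $j$ are zero. $\epsilon$-subspace embedding: $S\in\mathbb{R}^{m\times n}$ is an $\epsilon$-subspace embedding for $A\in\mathbb{R}^{n\times d}$ if $(1-\epsilon)\|Ax\|_2^2\le\|SAx\|_2^2\le(1+\epsilon)\|Ax\|_2^2$ for all $x\in\mathbb{R}^d$. *)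

(* Defs.v *)
From HB Require Import structures.
From mathcomp Require Import all_boot all_order all_algebra.
From mathcomp Require Import all_classical all_reals all_analysis.

Set Implicit Arguments.
Unset Strict Implicit.
Unset Printing Implicit Defensive.

Import Order.TTheory GRing.Theory Num.Theory.

Local Open Scope classical_set_scope.
Local Open Scope ring_scope.

(* The norm `|_| that the library puts on matrices is the sup norm, hence the
   separate Euclidean norm. *)
Definition norm2 (R : realType) (n : nat) (x : 'cV[R]_n) : R :=
  Num.sqrt (\sum_(i < n) x i 0 ^+ 2).

(* [s] is the diagonal of Sigma. *)
Definition compact_svd (R : realType) (n d r : nat) (A : 'M[R]_(n, d))
    (U : 'M[R]_(n, r)) (s : 'rV[R]_r) (V : 'M[R]_(d, r)) : Prop :=
  [/\ U^T *m U = 1%:M, V^T *m V = 1%:M, forall i, 0 < s 0 i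
    & A = U *m diag_mx s *m V^T].

Definition max_row_norm (R : realType) (n r : nat) (U : 'M[R]_(n, r)) : R :=
  \big[Num.max/0]_(i < n) norm2 (row i U)^T.

(* The relation "mu(A) = mu". A compact SVD is not unique, but the value does
   not depend on the one chosen: see [coherence_unique]. *)
Definition is_coherence (R : realType) (n d : nat) (A : 'M[R]_(n, d))
    (mu : R) : Prop :=
  exists (U : 'M[R]_(n, \rank A)) (s : 'rV[R]_(\rank A))
         (V : 'M[R]_(d, \rank A)),
    compact_svd A U s V /\ mu = max_row_norm U.

Lemma norm2_mxE (R : realType) (n : nat) (x : 'rV[R]_n) :
  norm2 x^T = Num.sqrt ((x *m x^T) 0 0).
Proof.
by rewrite /norm2 mxE; congr Num.sqrt; apply: eq_bigr => i _; rewrite !mxE expr2.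
Qed.

Lemma compact_svd_max_row_norm (R : realType) (n d r : nat)
    (A : 'M[R]_(n, d)) (U U' : 'M[R]_(n, r)) (s s' : 'rV[R]_r)
    (V V' : 'M[R]_(d, r)) :
  compact_svd A U s V -> compact_svd A U' s' V' ->
  max_row_norm U = max_row_norm U'.
Proof.
move=> [UU VV s0 AE] [UU' VV' s0' AE'].
pose t := \row_i (s' 0 i)^-1.
have st : diag_mx s' *m diag_mx t = 1%:M.
  rewrite mulmx_diag -(@diag_const_mx _ _ 1); congr diag_mx.
  by apply/rowP => i; rewrite !mxE divff // gt_eqF.
have U'E : U' = U *m (diag_mx s *m V^T *m V' *m diag_mx t).
  rewrite !mulmxA -AE AE' -(mulmxA _ V'^T) VV' mulmx1.
  by rewrite -mulmxA st mulmx1.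
move: (diag_mx s *m V^T *m V' *m diag_mx t) U'E => Q U'E.
have QQ : Q *m Q^T = 1%:M.
  apply: mulmx1C; rewrite -UU' U'E trmx_mul mulmxA -(mulmxA _ U^T) UU mulmx1.
  by [].
apply: eq_bigr => i _; rewrite !norm2_mxE U'E row_mul trmx_mul mulmxA.
by rewrite -(mulmxA _ Q) QQ mulmx1.
Qed.

Lemma coherence_unique (R : realType) (n d : nat) (A : 'M[R]_(n, d))
    (mu mu' : R) :
  is_coherence A mu -> is_coherence A mu' -> mu = mu'.
Proof.
move=> [U [s [V [svd ->]]]] [U' [s' [V' [svd' ->]]]].
exact: compact_svd_max_row_norm svd svd'.
Qed.

Definition subspace_embedding (R : realType) (m n d : nat) (eps : R)
    (A : 'M[R]_(n, d)) (S : 'M[R]_(m, n)) : Prop :=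
  forall x : 'cV[R]_d,
    (1 - eps) * norm2 (A *m x) ^+ 2 <= norm2 (S *m A *m x) ^+ 2
    /\ norm2 (S *m A *m x) ^+ 2 <= (1 + eps) * norm2 (A *m x) ^+ 2.

(* Mutual independence of a finite family of discrete random elements. *)
Definition mutually_independent (R : realType) (disp : measure_display)
    (T : measurableType disp) (P : probability T R) (I : finType) (V : Type)
    (X : I -> T -> V) : Prop :=
  forall (J : {set I}) (B : I -> set V),
    P (\bigcap_(j in [set` J]) X j @^-1` B j) =
    (\prod_(j in J) P (X j @^-1` B j))%E.

(* [x j] gives the row of the nonzero entry of column j and its sign bit,
   [true] standing for -1. *)
Definition hashing_of (R : realType) (m n : nat) (x : 'I_n -> 'I_m * bool) :
    'M[R]_(m, n) :=
  \matrix_(i, j) if i == (x j).1 then (-1) ^+ (x j).2 else 0.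

Definition hashing_matrix (R : realType) (disp : measure_display)
    (T : measurableType disp) (P : probability T R) (m n : nat)
    (S : T -> 'M[R]_(m, n)) : Prop :=
  exists X : 'I_n -> T -> 'I_m * bool,
    [/\ forall j (B : set ('I_m * bool)), measurable (X j @^-1` B),
        mutually_independent P X,
        forall j (i : 'I_m) (b : bool),
          P (X j @^-1` [set (i, b)]) = (m%:R^-1 * 2^-1)%:E
      & forall t, S t = hashing_of R (X ^~ t)].

Definition mu_bar (R : realType) (C1 C2 E : R) (r : nat) (eps delta : R) : R :=
  let L := 4 * r%:R + ln delta^-1 in
  C1 * Num.sqrt C2 * Num.sqrt eps *
  Num.min (ln (E / (C2 * eps)) / L) (Num.sqrt (ln E / L)).

(* Main.v *)
Require Import Defs.
From HB Require Import structures.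
From mathcomp Require Import all_boot all_order all_algebra.
From mathcomp Require Import all_classical all_reals all_analysis.
From mathcomp Require Import ring lra zify.

(* For one vector x = U w, |S x|^2 - |x|^2 is a sum over the rows b of S of
   the off-diagonal parts Y_b of (sum_j z_j)^2, where z_j is the signed entry
   of x hashed into row b.  Monomials in the z_j have nonnegative mean, and
   distinct rows are negatively correlated, so the q-th moment of sum_b Y_b is
   at most q! lam^-q (sum_(k <= q) lam^k E[Y_b^k] / k!)^m for every lam > 0.
   Dropping the terms that involve a single column,
   t^2k E[Y_b^k] / (2k)! <=
     E[exp (t sum_j z_j)] - 1 - sum_j (E[exp (t z_j)] - 1) <= U^2 exp U
   with  U = t^2 exp (t nu) / m,  where nu bounds the |x_j|; one
   takes t^2 proportional to k lam, lam proportional to L / eps and q between L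
   and 2 L, where L = 4 r + ln (1 / delta).  The two terms in the minimum
   defining the coherence bound control exp U and U^2 respectively.  Markov's
   inequality and a union bound over a lattice net of at most 2^(18 r) points
   of the unit ball of R^r conclude. *)

Set Implicit Arguments.
Unset Strict Implicit.
Unset Printing Implicit Defensive.

Import Order.TTheory GRing.Theory Num.Theory.
Import numFieldNormedType.Exports.

Local Open Scope classical_set_scope.
Local Open Scope ring_scope.

(** * Means over the outcomes of hashing *)

Definition mean (R : realType) (m n : nat)
    (f : {ffun 'I_n -> 'I_m * bool} -> R) : R :=
  \sum_w (m%:R^-1 * 2^-1) ^+ n * f w.

Definition column_mean (R : realType) (m : nat) (phi : 'I_m * bool -> R) : R :=
  \sum_c m%:R^-1 * 2^-1 * phi c.

Section Mean.
Variables (R : realType) (m n : nat).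
Implicit Types f g : {ffun 'I_n -> 'I_m * bool} -> R.

Lemma mean_prod (phi : 'I_n -> 'I_m * bool -> R) :
  mean (fun w => \prod_j phi j (w j)) = \prod_j column_mean (phi j).
Proof.
rewrite /mean /column_mean bigA_distr_bigA /=; apply: eq_bigr => w _.
by rewrite big_split /= prodr_const card_ord.
Qed.

Lemma eq_mean f g : f =1 g -> mean f = mean g.
Proof. by move=> fg; apply: eq_bigr => w _; rewrite fg. Qed.

Lemma meanD f g : mean (fun w => f w + g w) = mean f + mean g.
Proof. by rewrite /mean -big_split; apply: eq_bigr => w _; rewrite mulrDr. Qed.

Lemma meanZ (c : R) f : mean (fun w => c * f w) = c * mean f.
Proof. by rewrite /mean mulr_sumr; apply: eq_bigr => w _; rewrite mulrCA. Qed.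

Lemma meanB f g : mean (fun w => f w - g w) = mean f - mean g.
Proof.
rewrite /mean -sumrB; apply: eq_bigr => w _; by rewrite mulrBr.
Qed.

Lemma mean_sum (I : Type) (s : seq I) (Q : pred I)
    (F : I -> {ffun 'I_n -> 'I_m * bool} -> R) :
  mean (fun w => \sum_(i <- s | Q i) F i w) = \sum_(i <- s | Q i) mean (F i).
Proof.
by rewrite exchange_big; apply: eq_bigr => w _; rewrite mulr_sumr.
Qed.

Lemma ler_mean f g : (forall w, f w <= g w) -> mean f <= mean g.
Proof.
move=> fg; apply: ler_sum => w _; exact: ler_wpM2l.
Qed.

Hypothesis m_gt0 : (0 < m)%N.

Lemma column_mean_cst (c : R) : column_mean (fun _ : 'I_m * bool => c) = c.
Proof.
rewrite /column_mean sumr_const card_prod card_ord card_bool.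
rewrite -(mulr_natl _ (m * 2)) natrM.
by field; rewrite pnatr_eq0 -lt0n.
Qed.

Lemma mean_cst (c : R) :
  mean (fun _ : {ffun 'I_n -> 'I_m * bool} => c) = c.
Proof.
rewrite (eq_mean (g := fun w => c * \prod_(j < n) 1)); last first.
  by move=> w; rewrite big1 ?mulr1.
rewrite meanZ (mean_prod (fun (_ : 'I_n) (_ : 'I_m * bool) => 1)).
rewrite big1 ?mulr1 // => j _.
exact: column_mean_cst.
Qed.

End Mean.

(* The semiring generated by the products over the columns of factors
   (y_j sigma_j)^a al(h_j), with al >= 0: odd powers a average to 0 and even
   ones are nonnegative, whatever the sign of y_j.  A factor that is not
   constantly 1 vanishes unless its column is hashed into [B]. *)
Definition factor (R : realType) (m : nat) (y : R) (B : {set 'I_m})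
    (phi : 'I_m * bool -> R) : Prop :=
  exists a : nat, exists al : 'I_m -> R,
    [/\ forall c, phi c = (y * (-1) ^+ c.2) ^+ a * al c.1,
        forall i, 0 <= al i
      & (forall c, phi c = 1) \/ (forall i, i \notin B -> al i = 0)].

Inductive cone (R : realType) (m n : nat) (y : 'I_n -> R) (B : {set 'I_m}) :
    ({ffun 'I_n -> 'I_m * bool} -> R) -> Prop :=
| cone_zero : cone y B (fun=> 0)
| cone_cons (phi : 'I_n -> 'I_m * bool -> R) f :
    (forall j, factor (y j) B (phi j)) -> cone y B f ->
    cone y B (fun w => \prod_j phi j (w j) + f w).

Section Factor.
Variables (R : realType) (m : nat) (y : R).
Implicit Types (B : {set 'I_m}) (phi psi : 'I_m * bool -> R).

Lemma factor1 B : factor y B (fun=> 1).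
Proof.
exists 0%N, (fun=> 1); split=> // [c|]; last by left.
by rewrite expr0 mulr1.
Qed.

Lemma factorM B phi psi :
  factor y B phi -> factor y B psi -> factor y B (fun c => phi c * psi c).
Proof.
move=> [a [al [phiE al0 H]]] [b [be [psiE be0 K]]].
exists (a + b)%N, (fun i => al i * be i); split.
- by move=> c; rewrite phiE psiE exprD mulrACA.
- by move=> i; apply: mulr_ge0.
case: H K => [H [K|K]|H _].
- by left=> c; rewrite H K mulr1.
- by right=> i iB; rewrite K // mulr0.
- by right=> i iB; rewrite H // mul0r.
Qed.

Lemma factorS B B' phi : B \subset B' -> factor y B phi -> factor y B' phi.
Proof.
move=> BB' [a [al [phiE al0 H]]]; exists a, al; split=> //.
case: H => [|H]; [by left|right=> i iB'].
by apply: H; apply: contra iB' => /(fintype.subsetP BB').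
Qed.

Lemma column_mean_ge0 B phi : factor y B phi -> 0 <= column_mean phi.
Proof.
move=> [a [al [phiE al0 _]]]; rewrite /column_mean.
under eq_bigr do rewrite phiE.
rewrite (eq_bigr (fun c => (fun i b => m%:R^-1 * 2^-1 *
   ((y * (-1) ^+ (b : bool)) ^+ a * al i)) c.1 c.2)) //.
rewrite -(pair_bigA _ (fun i b => m%:R^-1 * 2^-1 *
   ((y * (-1) ^+ (b : bool)) ^+ a * al i))) /=.
apply: sumr_ge0 => i _; rewrite -mulr_sumr -mulr_suml big_bool /=.
apply: mulr_ge0; first by rewrite mulr_ge0 // invr_ge0.
apply: mulr_ge0 => //; rewrite expr1 expr0 mulr1 mulrN1 exprNn.
rewrite -signr_odd; case: (boolP (odd a)) => [|oa].
  by rewrite expr1 mulN1r addNr.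
by rewrite expr0 mul1r addr_ge0 // exprn_even_ge0.
Qed.

Lemma column_mean_negcorr B B' phi psi : (0 < m)%N -> [disjoint B & B']%bool ->
  factor y B phi -> factor y B' psi ->
  0 <= column_mean (fun c => phi c * psi c)
    <= column_mean phi * column_mean psi.
Proof.
move=> m0 dB fphi fpsi.
have p0 := column_mean_ge0 fphi; have q0 := column_mean_ge0 fpsi.
case: (fphi) (fpsi) => a [al [phiE al0 H]] [b [be [psiE be0 K]]].
case: H K => [H _|H [K|K]].
- have -> : phi = fun=> 1 by apply/funext.
  have -> : (fun c => 1 * psi c) = psi by apply/funext => c; rewrite mul1r.
  by rewrite column_mean_cst // mul1r q0 lexx.
- have -> : psi = fun=> 1 by apply/funext.
  have -> : (fun c => phi c * 1) = phi by apply/funext => c; rewrite mulr1.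
  by rewrite column_mean_cst // mulr1 p0 lexx.
have -> : (fun c => phi c * psi c) = fun=> 0.
  apply/funext => c; rewrite phiE psiE; case: (boolP (c.1 \in B)) => [cB|cB].
    by rewrite (K c.1) ?mulr0 // (disjointFr dB cB).
  by rewrite H // mulr0 mul0r.
by rewrite column_mean_cst // lexx mulr_ge0.
Qed.

End Factor.

Section Cone.
Variables (R : realType) (m n : nat) (y : 'I_n -> R).
Implicit Types (B : {set 'I_m}) (f g : {ffun 'I_n -> 'I_m * bool} -> R).

Lemma eq_cone B f g : f =1 g -> cone y B f -> cone y B g.
Proof. by move=> /funext ->. Qed.

Lemma coneD B f g :
  cone y B f -> cone y B g -> cone y B (fun w => f w + g w).
Proof.
move=> cf cg; elim: {f} cf => [|phi f fphi _ IH].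
  by apply: eq_cone cg => w; rewrite add0r.
by apply: eq_cone (cone_cons fphi IH) => w; rewrite addrA.
Qed.

Lemma cone_prod B (phi : 'I_n -> 'I_m * bool -> R) :
  (forall j, factor (y j) B (phi j)) -> cone y B (fun w => \prod_j phi j (w j)).
Proof.
move=> fphi; apply: eq_cone (cone_cons fphi (cone_zero y B)) => w.
by rewrite addr0.
Qed.

Lemma coneM B f g :
  cone y B f -> cone y B g -> cone y B (fun w => f w * g w).
Proof.
move=> cf cg; elim: {f} cf => [|phi f fphi _ IH].
  by apply: eq_cone (cone_zero y B) => w; rewrite mul0r.
suff cphi : cone y B (fun w => \prod_j phi j (w j) * g w).
  by apply: eq_cone (coneD cphi IH) => w; rewrite mulrDl.
elim: {g IH} cg => [|psi g fpsi _ IH].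
  by apply: eq_cone (cone_zero y B) => w; rewrite mulr0.
have fM j := factorM (fphi j) (fpsi j).
by apply: eq_cone (cone_cons fM IH) => w; rewrite big_split mulrDr.
Qed.

Lemma cone1 B : cone y B (fun=> 1).
Proof.
apply: eq_cone (cone_prod (fun j => factor1 (y j) B)) => w.
by rewrite big1.
Qed.

Lemma coneX B f k : cone y B f -> cone y B (fun w => f w ^+ k).
Proof.
move=> cf; elim: k => [|k IH]; first exact: cone1.
by apply: eq_cone (coneM cf IH) => w; rewrite exprS.
Qed.

Lemma cone_sum B (I : Type) (s : seq I) (Q : pred I)
    (F : I -> {ffun 'I_n -> 'I_m * bool} -> R) :
  (forall i, Q i -> cone y B (F i)) ->
  cone y B (fun w => \sum_(i <- s | Q i) F i w).
Proof.
move=> cF; elim: s => [|i s IH].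
  by apply: eq_cone (cone_zero y B) => w; rewrite big_nil.
case Qi: (Q i); last by apply: eq_cone IH => w; rewrite big_cons Qi.
by apply: eq_cone (coneD (cF i Qi) IH) => w; rewrite big_cons Qi.
Qed.

Lemma coneS B B' f : B \subset B' -> cone y B f -> cone y B' f.
Proof.
move=> BB'; elim=> [|phi g fphi _ IH]; first exact: cone_zero.
by apply: cone_cons => // j; apply: factorS (fphi j).
Qed.

Lemma mean_cone_ge0 B f : cone y B f -> 0 <= mean f.
Proof.
elim=> [|phi g fphi _ IH].
  by rewrite /mean big1 // => w _; rewrite mulr0.
rewrite meanD mean_prod addr_ge0 // prodr_ge0 // => j _.
exact: column_mean_ge0 (fphi j).
Qed.

Lemma mean_negcorr B B' f g : (0 < m)%N -> [disjoint B & B']%bool ->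
  cone y B f -> cone y B' g -> mean (fun w => f w * g w) <= mean f * mean g.
Proof.
move=> m0 dB cf cg.
have z0 : mean (fun _ : {ffun 'I_n -> 'I_m * bool} => 0 : R) = 0.
  exact: mean_cst.
elim: cf => [|phi {}f fphi _ IH].
  by rewrite z0 mul0r (eq_mean (g := fun=> 0)) ?z0 // => w; rewrite mul0r.
rewrite (eq_mean (fun w => mulrDl _ _ (g w))) !meanD mulrDl lerD // {f IH}.
elim: cg => [|psi {}g fpsi _ IH].
  by rewrite z0 mulr0 (eq_mean (g := fun=> 0)) ?z0 // => w; rewrite mulr0.
rewrite (eq_mean (fun w => mulrDr _ _ _)) !meanD mulrDr lerD // {g IH}.
rewrite (eq_mean (g := fun w => \prod_j (phi j (w j) * psi j (w j))));
  last by move=> w; rewrite big_split.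
rewrite (mean_prod (fun j c => phi j c * psi j c)) !mean_prod -big_split /=.
apply: ler_prod => j _; exact: column_mean_negcorr (fphi j) (fpsi j).
Qed.

End Cone.

(** * Moments of one row *)

Lemma expR_sub1D_le (R : realType) (s : R) :
  expR s - 1 - s <= s ^+ 2 * expR `|s|.
Proof.
have [s0|s0] := leP 0 s.
  rewrite ger0_norm //; have [s1|s1] := leP 1 s.
    have := expR_gt0 s; have : 1 <= s ^+ 2 by rewrite exprn_ege1.
    by nra.
  have e1 : expR s * (1 - s) <= 1.
    rewrite -[leRHS](expRxMexpNx_1 s) ler_pM2l ?expR_gt0 //.
    exact: expR_ge1Dx.
  by nra.
have [v v0 ->] : exists2 v, 0 < v & s = - v.
  by exists (- s); rewrite ?oppr_gt0 ?opprK.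
rewrite normrN gtr0_norm // sqrrN opprK.
have e1 : expR (- v) * (1 + v) <= 1.
  rewrite -[leRHS](expRxMexpNx_1 v) mulrC ler_pM2r ?expR_gt0 //.
  exact: expR_ge1Dx.
have e2 : 1 <= expR v by rewrite -expR0 ler_expR ltW.
have e3 : expR (- v) - 1 + v <= v ^+ 2.
  have : (expR (- v) - 1 + v - v ^+ 2) * (1 + v) <= 0 by nra.
  rewrite pmulr_lle0; last by rewrite addr_gt0.
  by rewrite subr_le0.
by rewrite (le_trans e3) // ler_peMr // sqr_ge0.
Qed.

Lemma prod_1D_sub_le (R : realType) (I : finType) (u : I -> R) :
  (forall i, 0 <= u i) ->
  \prod_i (1 + u i) - 1 - \sum_i u i <=
  (\sum_i u i) ^+ 2 * expR (\sum_i u i).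
Proof.
move=> u0; have U0 : 0 <= \sum_i u i by apply: sumr_ge0.
have := expR_sub1D_le (\sum_i u i); rewrite (ger0_norm U0); apply: le_trans.
rewrite !lerD2r expR_sum; apply: ler_prod => i _.
by rewrite addr_ge0 ?expR_ge1Dx.
Qed.

Definition entry (R : realType) (m : nat) (b : 'I_m) (y : R)
    (c : 'I_m * bool) : R :=
  if b == c.1 then y * (-1) ^+ c.2 else 0.

Section Bucket.
Variables (R : realType) (m n : nat) (x : 'I_n -> R) (b : 'I_m).

Let z (j : 'I_n) (w : {ffun 'I_n -> 'I_m * bool}) : R := entry b (x j) (w j).

Definition bucket (w : {ffun 'I_n -> 'I_m * bool}) : R :=
  \sum_i \sum_(j | j != i) entry b (x i) (w i) * entry b (x j) (w j).

Lemma bucketE w :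
  bucket w = (\sum_j entry b (x j) (w j)) ^+ 2 -
             \sum_j entry b (x j) (w j) ^+ 2.
Proof.
rewrite expr2 mulr_suml -sumrB; apply: eq_bigr => i _.
by rewrite mulr_sumr [in RHS](bigD1 i) //= expr2 [RHS]addrC addKr.
Qed.

Lemma cone_entry j : cone x [set b] (z j).
Proof.
pose phi i (c : 'I_m * bool) : R := if i == j then entry b (x j) c else 1.
apply: (eq_cone (f := fun w => \prod_i phi i (w i))) => [w|].
  rewrite (bigD1 j) //= /phi eqxx big1 ?mulr1 // => i /negPf -> //.
apply: cone_prod => i; rewrite /phi; case: eqP => [->|_]; last exact: factor1.
exists 1%N, (fun i => (b == i)%:R); split=> [c||].
- by rewrite /entry expr1; case: (b == c.1); rewrite ?mulr1 ?mulr0.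
- by move=> k; rewrite ler0n.
- by right=> k; rewrite inE eq_sym => /negPf ->.
Qed.

Lemma cone_bucket : cone x [set b] bucket.
Proof.
apply: cone_sum => i _; apply: cone_sum => j _.
by apply: (coneM (cone_entry i) (cone_entry j)).
Qed.

Let Z w := \sum_j z j w.

Let coneZ : cone x [set b] Z.
Proof. by apply: cone_sum => j _; apply: cone_entry. Qed.

Let mul_sum_split (f g : 'I_n -> R) :
  (\sum_i f i) * (\sum_j g j) =
  \sum_j f j * g j + \sum_j \sum_(i | i != j) f i * g j.
Proof.
rewrite mulr_sumr -big_split; apply: eq_bigr => j _.
by rewrite mulr_suml (bigD1 j).
Qed.

Let cone_cross p q : cone x [set b]
  (fun w => \sum_j \sum_(i | i != j) z i w ^+ p * z j w ^+ q).
Proof.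
apply: cone_sum => j _; apply: cone_sum => i _.
by apply: (coneM (coneX p (cone_entry i)) (coneX q (cone_entry j))).
Qed.

Let cone_pow_sum p : cone x [set b] (fun w => \sum_j z j w ^+ p).
Proof. by apply: cone_sum => j _; apply: coneX (cone_entry j). Qed.

Let cone_powD p : cone x [set b] (fun w => Z w ^+ p.+1 - \sum_j z j w ^+ p.+1).
Proof.
elim: p => [|p IH].
  apply: eq_cone (cone_zero _ _) => w; rewrite expr1.
  by under [X in _ - X]eq_bigr do rewrite expr1; rewrite subrr.
apply: eq_cone (coneD (coneM coneZ IH) (cone_cross 1 p.+1)) => w /=.
under [X in _ + X]eq_bigr do under eq_bigr do rewrite expr1.
rewrite mulrBr -exprS {3}/Z mul_sum_split.
under [X in _ - (X + _)]eq_bigr do rewrite -exprS.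
ring.
Qed.

Let cone_bucketD k : cone x [set b]
  (fun w => Z w ^+ (k.+1).*2 - \sum_j z j w ^+ (k.+1).*2 - bucket w ^+ k.+1).
Proof.
elim: k => [|k IH].
  by apply: eq_cone (cone_zero _ _) => w; rewrite bucketE expr1 subrr.
have c1 := coneM (coneX 2 coneZ) IH.
have c2 := coneM (cone_pow_sum 2) (coneX k.+1 cone_bucket).
have c3 := coneM cone_bucket (cone_pow_sum (k.+1).*2).
apply: eq_cone (coneD (coneD c1 c2) (coneD c3 (cone_cross 2 (k.+1).*2))) => w.
have := mul_sum_split (fun j => z j w ^+ 2) (fun j => z j w ^+ (k.+1).*2).
under [X in _ = X + _ -> _]eq_bigr do rewrite -exprD add2n -doubleS.
have := bucketE w; rewrite /= -/(Z w).
have -> : Z w ^+ (k.+2).*2 = Z w ^+ 2 * Z w ^+ (k.+1).*2.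
  by rewrite -exprD add2n doubleS.
rewrite (exprS (bucket w) k.+1) /z.
move: (bucket w) (Z w) => y v; do 4!move: (\sum_j _) => ?.
by move=> -> H; ring: H.
Qed.

Lemma mean_bucket_le (t : R) (k : nat) : (0 < m)%N -> 0 < t ->
  t ^+ (k.+1).*2 / ((k.+1).*2)`!%:R * mean (fun w => bucket w ^+ k.+1) <=
  mean (fun w => expR (t * Z w) - \sum_j expR (t * z j w)) + n%:R - 1.
Proof.
move=> m0 t0; set a := _ * mean _.
pose h N w : R := series (exp_coeff (t * Z w)) N -
               \sum_j series (exp_coeff (t * z j w)) N.
have hcvg : (fun N => mean (h N) + n%:R - 1) @ \oo -->
    mean (fun w => expR (t * Z w) - \sum_j expR (t * z j w)) + n%:R - 1.
  apply: cvgB; last exact: cvg_cst.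
  apply: cvgD; last exact: cvg_cst.
  apply: (cvg_big add_continuous) => w _; apply: cvgMl_tmp; apply: cvgB.
    exact: is_cvg_series_exp_coeff.
  by apply: (cvg_big add_continuous) => j _; apply: is_cvg_series_exp_coeff.
rewrite -(cvg_lim _ hcvg) //; apply: limr_ge.
  by apply/cvg_ex; eexists; exact: hcvg.
exists (k.+1).*2.+1 => // -[//|N] /= Nk; rewrite ltnS in Nk.
have hE w : h N.+1 w + n%:R - 1 =
   \sum_(p < N) t ^+ p.+1 / (p.+1)`!%:R *
     (Z w ^+ p.+1 - \sum_j z j w ^+ p.+1).
  have sE u : series (exp_coeff u) N.+1 =
      1 + \sum_(p < N) u ^+ p.+1 / (p.+1)`!%:R :> R.
    rewrite /series /= big_mkord big_ord_recl /exp_coeff /= expr0 fact0 divr1.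
    by [].
  rewrite /h sE; under [X in _ - X + _ - _]eq_bigr do rewrite sE.
  rewrite big_split /= sumr_const card_ord.
  rewrite [RHS](eq_bigr (fun p : 'I_N => (t * Z w) ^+ p.+1 / (p.+1)`!%:R -
     \sum_j (t * z j w) ^+ p.+1 / (p.+1)`!%:R)); last first.
    move=> p _; rewrite mulrBr mulr_sumr exprMn; congr (_ - _); first by ring.
    by apply: eq_bigr => j _; rewrite exprMn; ring.
  rewrite sumrB [X in _ = _ - X]exchange_big /=; ring.
have -> : mean (h N.+1) + n%:R - 1 = \sum_(p < N) t ^+ p.+1 / (p.+1)`!%:R *
     mean (fun w => Z w ^+ p.+1 - \sum_j z j w ^+ p.+1).
  rewrite -addrA -[X in _ + X](@mean_cst R m n) // -meanD.
  rewrite (eq_mean (fun w => etrans (addrA _ _ _) (hE w))) mean_sum.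
  by apply: eq_bigr => p _; rewrite meanZ.
have c0 p : 0 <= t ^+ p / p`!%:R :> R.
  by rewrite divr_ge0 // exprn_ge0 // ltW.
have kN : ((k.*2).+1 < N)%N by rewrite -doubleS.
rewrite (bigD1 (Ordinal kN)) //= -doubleS.
rewrite -[leLHS]addr0 lerD //; last first.
  apply: sumr_ge0 => p _; apply: mulr_ge0 => //.
  exact: mean_cone_ge0 (cone_powD p).
apply: ler_wpM2l => //; rewrite -subr_ge0 -meanB.
exact: mean_cone_ge0 (cone_bucketD k).
Qed.

Lemma mean_bucket_pow (t nu U : R) (k : nat) : (0 < m)%N -> 0 < t ->
  (forall j, `|x j| <= nu) -> \sum_j x j ^+ 2 <= 1 ->
  U = t ^+ 2 * expR (t * nu) / m%:R ->
  t ^+ (k.+1).*2 / ((k.+1).*2)`!%:R * mean (fun w => bucket w ^+ k.+1) <=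
  U ^+ 2 * expR U.
Proof.
move=> m0 t0 xnu x1 UE.
have mR : (0 : R) < m%:R by rewrite ltr0n.
pose u j : R := (expR (t * x j) + expR (- (t * x j)) - 2) / (2 * m%:R).
have uE j : column_mean (fun c => expR (t * entry b (x j) c)) = 1 + u j.
  rewrite /column_mean.
  rewrite (eq_bigr (fun c => m%:R^-1 * 2^-1 +
     m%:R^-1 * 2^-1 * (expR (t * entry b (x j) c) - 1))); last first.
    by move=> c _; ring.
  rewrite big_split /=; congr (_ + _).
    rewrite -[RHS](column_mean_cst m0 1).
    by apply: eq_bigr => c _; rewrite mulr1.
  rewrite (bigD1 (b, true)) //= (bigD1 (b, false)) ?xpair_eqE ?andbF //=.
  rewrite [X in _ + (_ + X)]big1; last first.
    move=> [i s]; rewrite /entry /= !xpair_eqE.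
    have [_|_ _] := eqVneq b i; last by rewrite mulr0 expR0 subrr mulr0.
    by case: s.
  rewrite /entry /= eqxx expr0 expr1 mulr1 mulrN1 mulrN /u.
  by field; rewrite pnatr_eq0 -lt0n.
have u0 j : 0 <= u j.
  rewrite /u divr_ge0 //.
  have := expR_ge1Dx (t * x j); have := expR_ge1Dx (- (t * x j)); lra.
have ule j : u j <= x j ^+ 2 * U.
  have -> : x j ^+ 2 * U = (t * x j) ^+ 2 * expR (t * nu) * 2 / (2 * m%:R).
    by rewrite UE; field; rewrite pnatr_eq0 -lt0n.
  rewrite /u ler_pM2r ?invr_gt0 ?mulr_gt0 //.
  have le1 : expR `|t * x j| <= expR (t * nu).
    by rewrite ler_expR normrM gtr0_norm // ler_pM2l.
  have le2 := ler_wpM2l (sqr_ge0 (t * x j)) le1.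
  have := expR_sub1D_le (t * x j); have := expR_sub1D_le (- (t * x j)).
  rewrite normrN sqrrN; lra.
have U0 : 0 <= U by rewrite UE divr_ge0 ?mulr_ge0 ?expR_ge0 ?sqr_ge0 ?ltW.
have SU : \sum_j u j <= U.
  apply: (@le_trans _ _ ((\sum_j x j ^+ 2) * U)).
    by rewrite mulr_suml; apply: ler_sum.
  by rewrite -[leRHS]mul1r ler_wpM2r.
apply: (le_trans (mean_bucket_le k m0 t0)).
have -> : mean (fun w => expR (t * Z w) - \sum_j expR (t * z j w)) + n%:R - 1
   = \prod_j (1 + u j) - 1 - \sum_j u j.
  rewrite meanB mean_sum.
  have -> : mean (fun w => expR (t * Z w)) = \prod_j (1 + u j).
    under [RHS]eq_bigr do rewrite -uE.
    rewrite -(mean_prod (fun j c => expR (t * entry b (x j) c))).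
    by apply: eq_mean => w; rewrite mulr_sumr expR_sum.
  have -> : \sum_j mean (fun w => expR (t * z j w)) = \sum_j (1 + u j).
    apply: eq_bigr => j _.
    pose phi i (c : 'I_m * bool) : R :=
      if i == j then expR (t * entry b (x j) c) else 1.
    rewrite (eq_mean (g := fun w => \prod_i phi i (w i))); last first.
      move=> w; rewrite (bigD1 j) //= /phi eqxx big1 ?mulr1 //.
      by move=> i /negPf ->.
    rewrite mean_prod (bigD1 j) //= big1 /phi ?eqxx ?mulr1 ?uE //.
    by move=> i /negPf ->; exact: column_mean_cst.
  rewrite big_split /= sumr_const card_ord; ring.
apply: (le_trans (prod_1D_sub_le u0)).
have S0 : 0 <= \sum_j u j by apply: sumr_ge0.
by rewrite ler_pM ?expR_ge0 ?sqr_ge0 ?ler_expR // ler_pXn2r.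
Qed.

End Bucket.

(** * Moments of the sum over the rows *)

Lemma ler_trans_eq (R : numDomainType) (a b c d : R) :
  a <= b -> a = c -> b = d -> c <= d.
Proof. by move=> + <- <-. Qed.

Lemma ffact_le_expn (n k : nat) : (n ^_ k <= n ^ k)%N.
Proof.
elim: k => [|k IH] //.
by rewrite ffactnSr expnSr leq_mul // leq_subr.
Qed.

Lemma fact_le_expn (n : nat) : (n`! <= n ^ n)%N.
Proof. by rewrite -ffactnn ffact_le_expn. Qed.

Lemma fact_double_le (k : nat) : ((k.*2)`! <= k`! * (k.*2) ^ k)%N.
Proof.
have kk : (k <= k.*2)%N by rewrite -addnn leq_addr.
have := ffact_fact kk.
have -> : (k.*2 - k)%N = k by rewrite -addnn addnK.
move=> <-.
by rewrite mulnC leq_mul2l ffact_le_expn orbT.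
Qed.

Lemma sqr_le_exp2 (k : nat) : (k ^ 2 <= 2 * 2 ^ k)%N.
Proof.
elim: k => [//|[//|[//|[//|k]]] IH].
rewrite expnS mulnCA; apply: leq_trans (leq_mul (leqnn 2) IH).
by rewrite -!mulnn; nia.
Qed.

Section BucketSum.
Variables (R : realType) (m n : nat) (x : 'I_n -> R).
Hypothesis m_gt0 : (0 < m)%N.

(* Moments of a sum over buckets are compared with those of independent
   summands, for which the truncated exponential series is submultiplicative. *)
Lemma mean_bucket_sum_pow (s : seq 'I_m) (lam F : R) (Q q : nat) :
  uniq s -> 0 < lam -> (q <= Q)%N ->
  (forall b : 'I_m, \sum_(k < Q.+1)
     lam ^+ k / k`!%:R * mean (fun w => bucket x b w ^+ k) <= F) ->
  lam ^+ q / q`!%:R * mean (fun w => (\sum_(b <- s) bucket x b w) ^+ q) <=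
  F ^+ size s.
Proof.
move=> us lam0 qQ HF.
have c0 k : 0 <= lam ^+ k / k`!%:R by rewrite divr_ge0 // exprn_ge0 // ltW.
elim: s us q qQ => [_|b s IH /= /andP[bs us]] q qQ.
  case: q qQ => [|q] _.
    under eq_mean do rewrite expr0.
    by rewrite mean_cst // expr0 fact0 divr1 mulr1.
  under eq_mean do rewrite big_nil exprS mul0r.
  by rewrite mean_cst // mulr0 expr0.
pose V w := \sum_(c <- s) bucket x c w.
have cV : cone x [set c in s] V.
  apply: (eq_cone (f := fun w => \sum_(c <- s | c \in s) bucket x c w)) => [w|].
    by rewrite -big_seq.
  apply: cone_sum => c cs; apply: coneS (cone_bucket x c).
  by rewrite finset.sub1set inE.
have dV : [disjoint [set c in s]%SET & [set b]%SET]%bool.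
  by rewrite disjoint_sym disjoints1 inE.
have F0 : 0 <= F.
  apply: le_trans (HF b); apply: sumr_ge0 => k _; apply: mulr_ge0 => //.
  exact: mean_cone_ge0 (coneX _ (cone_bucket x b)).
have -> : mean (fun w => (\sum_(c <- b :: s) bucket x c w) ^+ q) =
    \sum_(i < q.+1) 'C(q, i)%:R *
      mean (fun w => V w ^+ (q - i) * bucket x b w ^+ i).
  rewrite (eq_mean (g := fun w => \sum_(i < q.+1) 'C(q, i)%:R *
     (V w ^+ (q - i) * bucket x b w ^+ i))); last first.
    move=> w; rewrite big_cons addrC exprDn; apply: eq_bigr => i _.
    by rewrite mulr_natl.
  by rewrite mean_sum; apply: eq_bigr => i _; rewrite meanZ.
apply: (@le_trans _ _ (\sum_(i < q.+1) F ^+ size s *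
  (lam ^+ i / i`!%:R * mean (fun w => bucket x b w ^+ i)))).
  rewrite mulr_sumr; apply: ler_sum => -[i /= iq] _; rewrite ltnS in iq.
  have -> : lam ^+ q / q`!%:R * ('C(q, i)%:R *
      mean (fun w => V w ^+ (q - i) * bucket x b w ^+ i)) =
    (lam ^+ (q - i) / (q - i)`!%:R) * (lam ^+ i / i`!%:R) *
      mean (fun w => V w ^+ (q - i) * bucket x b w ^+ i).
    rewrite -(bin_fact iq) !natrM -{1}(subnK iq) exprD; field.
    by rewrite !pnatr_eq0 -!lt0n !fact_gt0 bin_gt0 iq.
  apply: (@le_trans _ _ ((lam ^+ (q - i) / (q - i)`!%:R) * (lam ^+ i / i`!%:R) *
     (mean (fun w => V w ^+ (q - i)) * mean (fun w => bucket x b w ^+ i)))).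
    apply: ler_wpM2l; first exact: mulr_ge0.
    exact: mean_negcorr dV (coneX _ cV) (coneX _ (cone_bucket x b)).
  rewrite mulrACA; apply: ler_wpM2r.
    apply: mulr_ge0 => //; exact: mean_cone_ge0 (coneX _ (cone_bucket x b)).
  by apply: IH => //; rewrite (leq_trans (leq_subr _ _)).
rewrite -mulr_sumr exprSr; apply: ler_wpM2l; first exact: exprn_ge0.
apply: le_trans (HF b).
rewrite -!(big_mkord xpredT
  (fun i => lam ^+ i / i`!%:R * mean (fun w => bucket x b w ^+ i))).
rewrite [leRHS](big_cat_nat (n := q.+1)) //= lerDl sumr_ge0 // => k _.
by apply: mulr_ge0 => //; exact: mean_cone_ge0 (coneX _ (cone_bucket x b)).
Qed.

End BucketSum.

Lemma expR1_le4 (R : realType) : expR 1 <= 4 :> R.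
Proof.
have h := expR_ge1Dx (- 2^-1 : R); have e := expRxMexpNx_1 (2^-1 : R).
have e0 := expR_gt0 (2^-1 : R).
have -> : 1 = 2%:R * 2^-1 :> R by field.
by rewrite expRM_natl; nra.
Qed.

Section Tail.
Variables (R : realType) (m n : nat) (x : 'I_n -> R).
Variables (K C2 eps E L nu : R) (q : nat).
Hypothesis m_gt0 : (0 < m)%N.
Hypothesis KE : K = 256 * (2 * 256).
Hypothesis C2E : C2 = (128 * K)^-1.
Hypothesis eps01 : 0 < eps < 1.
Hypothesis E_ge1 : 1 <= E.
Hypothesis L_gt0 : 0 < L.
Hypothesis Lq : L <= q%:R.
Hypothesis qL : q%:R <= 2 * L.
Hypothesis mE : E * C2 ^- 2 * eps ^- 2 * L <= m%:R.
Hypothesis nu_ge0 : 0 <= nu.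
Hypothesis nu_le1 : nu ^+ 2 <= C2 * eps / 4 * (ln E / L).
Hypothesis nu_le2 : nu ^+ 2 <= C2 * eps / 4 * (ln (E / (C2 * eps)) / L) ^+ 2.
Hypothesis x_le : forall j, `|x j| <= nu.
Hypothesis x_norm : \sum_j x j ^+ 2 <= 1.

Variable lam : R.
Hypothesis lamE : lam = K * L / eps.

Lemma bucket_moment (b : 'I_m) (k : nat) : (0 < k <= q)%N ->
  lam ^+ k / k`!%:R * mean (fun w => bucket x b w ^+ k) <=
  2 * 2 ^- k * (L / m%:R).
Proof.
case/andP=> k0 kq.
have [e0 e1] := andP eps01.
have mR : (0 : R) < m%:R by rewrite ltr0n.
have kR : (0 : R) < k%:R by rewrite ltr0n.
have K0 : 0 < K by rewrite KE; lra.
have lam0 : 0 < lam by rewrite lamE divr_gt0 // mulr_gt0.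
have C20 : 0 < C2 by rewrite C2E invr_gt0 mulr_gt0.
have C2K : C2 * (128 * K) = 1 by rewrite C2E mulVf // gt_eqF // mulr_gt0.
(* With this t, lam^k (2k)! / (k! t^2k) <= 64^-k. *)
pose t := Num.sqrt (128 * k%:R * lam).
have t0 : 0 < t by rewrite sqrtr_gt0 !mulr_gt0.
have t2 : t ^+ 2 = 128 * k%:R * lam by rewrite sqr_sqrtr // ltW // !mulr_gt0.
have kL : k%:R <= 2 * L by apply: le_trans qL; rewrite ler_nat.
have lnE0 : 0 <= ln E by apply: ln_ge0.
have tnu : (t * nu) ^+ 2 = 128 * K * k%:R * L * nu ^+ 2 / eps.
  by rewrite exprMn t2 lamE; field; rewrite gt_eqF.
have c0 : 0 <= 128 * K * k%:R * L / eps.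
  by rewrite divr_ge0 ?mulr_ge0 // ltW.
have tnu1 : (t * nu) ^+ 2 <= k%:R * ln E / 4.
  rewrite tnu; apply: ler_trans_eq (ler_wpM2l c0 nu_le1) _ _; first by ring.
  transitivity (C2 * (128 * K) * (k%:R * ln E / 4)); last by rewrite C2K mul1r.
  by field; rewrite !gt_eqF.
have tnu2 : (t * nu) ^+ 2 <= (ln (E / (C2 * eps))) ^+ 2.
  rewrite tnu; have := ler_wpM2l c0 nu_le2.
  have -> : 128 * K * k%:R * L / eps *
      (C2 * eps / 4 * (ln (E / (C2 * eps)) / L) ^+ 2)
    = (C2 * (128 * K)) * (k%:R / (4 * L) * ln (E / (C2 * eps)) ^+ 2).
    by field; rewrite !gt_eqF.
  rewrite C2K mul1r => H.
  apply: le_trans (ler_trans_eq H _ erefl) _; first by ring.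
  rewrite ler_piMl ?sqr_ge0 // ler_pdivrMr ?mul1r; lra.
have EC : 1 <= E / (C2 * eps).
  rewrite ler_pdivlMr ?mulr_gt0 // mul1r (le_trans _ E_ge1) //.
  have : C2 <= 1 by rewrite C2E KE invf_le1; lra.
  by nra.
pose G := expR (t * nu).
have G0 : 0 < G by apply: expR_gt0.
have G1 : G ^+ 2 <= E * expR k%:R.
  rewrite -[E]lnK ?posrE ?(lt_le_trans _ E_ge1) // -expRD /G -expRM_natl ler_expR.
  have tn0 : 0 <= t * nu by rewrite mulr_ge0 // ltW.
  have : (t * nu) ^+ 2 <= ((ln E + k%:R) / 2) ^+ 2.
    apply: le_trans tnu1 _.
    by rewrite expr_div_n; nra.
  rewrite ler_pXn2r // ?nnegrE ?divr_ge0 ?addr_ge0 //.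
  lra.
have G2 : G <= E / (C2 * eps).
  rewrite -[leRHS]lnK ?posrE ?(lt_le_trans _ EC) // ler_expR.
  by rewrite -(ler_pXn2r (n := 2)) // ?nnegrE ?mulr_ge0 ?ln_ge0 // ltW.
pose U := t ^+ 2 * G / m%:R.
have mE' : E * (128 * K) ^+ 2 * L <= m%:R * eps ^+ 2.
  move: mE; rewrite C2E exprVn invrK -(ler_pM2r (exprn_gt0 2 e0)) => H.
  by apply: ler_trans_eq H _ erefl; field; rewrite gt_eqF.
have Uk : U <= k%:R.
  rewrite /U t2 ler_pdivrMr // lamE.
  have -> : 128 * k%:R * (K * L / eps) * G = k%:R * (128 * K * L / eps * G).
    by ring.
  rewrite ler_pM2l // -(ler_pM2r (exprn_gt0 2 e0)); apply: le_trans mE'.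
  have -> : 128 * K * L / eps * G * eps ^+ 2 = 128 * K * L * (G * eps).
    by field; rewrite gt_eqF.
  have -> : E * (128 * K) ^+ 2 * L = 128 * K * L * (E * (128 * K)) by ring.
  rewrite ler_pM2l ?mulr_gt0 //.
  apply: ler_trans_eq (ler_wpM2r (ltW e0) G2) erefl _.
  by rewrite C2E; field; rewrite !gt_eqF.
have U0 : 0 <= U by rewrite /U t2 divr_ge0 ?mulr_ge0 // ltW.
have U2 : U ^+ 2 <= k%:R ^+ 2 * expR k%:R * (L / m%:R).
  have -> : U ^+ 2 = k%:R ^+ 2 *
      ((128 * K) ^+ 2 * L / (m%:R * eps ^+ 2) * G ^+ 2) * (L / m%:R).
    by rewrite /U t2 lamE; field; rewrite !gt_eqF.
  rewrite ler_pM2r ?divr_gt0 // ler_pM2l ?exprn_gt0 //.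
  have d0 : 0 <= (128 * K) ^+ 2 * L / (m%:R * eps ^+ 2).
    by rewrite divr_ge0 ?mulr_ge0 ?exprn_ge0 // ?mulr_ge0 // ltW.
  apply: le_trans (ler_wpM2l d0 G1) _.
  rewrite mulrA ler_piMl ?expR_ge0 // mulrAC ler_pdivrMr ?mulr_gt0 ?exprn_gt0 //.
  by rewrite mul1r; apply: ler_trans_eq mE' _ erefl; ring.
have UU : U ^+ 2 * expR U <= 16 ^+ k * k%:R ^+ 2 * (L / m%:R).
  apply: (@le_trans _ _ (k%:R ^+ 2 * expR k%:R * (L / m%:R) * expR k%:R)).
    by rewrite ler_pM ?expR_ge0 ?sqr_ge0 ?ler_expR.
  have -> : k%:R ^+ 2 * expR k%:R * (L / m%:R) * expR k%:R =
     (expR k%:R * expR k%:R) * (k%:R ^+ 2 * (L / m%:R)) by ring.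
  rewrite -[leRHS]mulrA; apply: ler_wpM2r.
    by rewrite mulr_ge0 ?sqr_ge0 // divr_ge0 // ltW.
  have -> : 16 = 4 * 4 :> R by ring.
  rewrite exprMn; have ek : expR k%:R <= 4 ^+ k :> R.
    by rewrite -[k%:R]mulr1 expRM_natl lerXn2r ?nnegrE ?expR_ge0 // expR1_le4.
  by rewrite ler_pM ?expR_ge0.
have := mean_bucket_pow b k.-1 m_gt0 t0 x_le x_norm (erefl : U = _).
rewrite prednK // -mul2n exprM t2 => M.
have f0 : (0 : R) < ((2 * k)`!)%:R by rewrite ltr0n fact_gt0.
set Y := mean _ in M *.
have Y0 : 0 <= Y.
  by apply: mean_cone_ge0 (coneX _ (cone_bucket x b)).
have fk : (((2 * k)`!)%:R : R) <= k`!%:R * (2 * k%:R) ^+ k.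
  by rewrite -natrM -natrX -natrM ler_nat mul2n fact_double_le.
have M2 : (64 * lam) ^+ k / k`!%:R * Y <= U ^+ 2 * expR U.
  apply: le_trans M; apply: ler_wpM2r => //.
  rewrite ler_pdivlMr // mulrAC ler_pdivrMr ?ltr0n ?fact_gt0 //.
  have -> : (128 * k%:R * lam) ^+ k * k`!%:R =
     (64 * lam) ^+ k * (k`!%:R * (2 * k%:R) ^+ k).
    rewrite [RHS]mulrCA -exprMn mulrC; congr (_ * _ ^+ _); ring.
  by apply: ler_wpM2l => //; rewrite exprn_ge0 // mulr_ge0 // ltW.
have -> : lam ^+ k / k`!%:R * Y = 64 ^- k * ((64 * lam) ^+ k / k`!%:R * Y).
  rewrite exprMn; field; rewrite pnatr_eq0 -lt0n fact_gt0 /=.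
  by rewrite expf_neq0.
rewrite mulrC ler_pdivrMr ?exprn_gt0 //.
apply: le_trans (le_trans M2 UU) _.
have -> : 2 * 2 ^- k * (L / m%:R) * 64 ^+ k = 16 ^+ k * (2 * 2 ^+ k) * (L / m%:R).
  have -> : 64 = 16 * 2 * 2 :> R by ring.
  by rewrite !exprMn; field; rewrite expf_neq0 //= gt_eqF.
rewrite ler_pM2r ?divr_gt0 // ler_pM2l ?exprn_gt0 //.
by rewrite -!natrX -natrM ler_nat sqr_le_exp2.
Qed.

Lemma mean_bucket_sum_le :
  mean (fun w => (\sum_(b < m) bucket x b w) ^+ q) <= (eps / (16 * 256)) ^+ q.
Proof.
have [e0 e1] := andP eps01.
have mR : (0 : R) < m%:R by rewrite ltr0n.
have K0 : 0 < K by rewrite KE; lra.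
have lam0 : 0 < lam by rewrite lamE divr_gt0 // mulr_gt0.
have LM : 0 < L / m%:R by rewrite divr_gt0.
have HF (b : 'I_m) : \sum_(k < q.+1) lam ^+ k / k`!%:R *
    mean (fun w => bucket x b w ^+ k) <= 1 + 2 * (L / m%:R).
  rewrite big_ord_recl expr0 fact0 divr1 mul1r.
  under eq_mean do rewrite expr0.
  rewrite mean_cst // lerD2l.
  apply: (@le_trans _ _ (\sum_(i < q) 2 ^- i * (L / m%:R))).
    apply: ler_sum => i _.
    have iq : (0 < i.+1 <= q)%N by rewrite /=.
    apply: ler_trans_eq (bucket_moment b iq) erefl _.
    by rewrite exprS; field; rewrite expf_neq0 //= gt_eqF.
  rewrite -mulr_suml ler_pM2r //.
  have : \sum_(i < q) 2 ^- i = 2 - 2 * 2 ^- q :> R.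
    elim: q => [|p IH]; first by rewrite big_ord0; field.
    by rewrite big_ord_recr /= IH exprS; field; rewrite expf_neq0.
  by move=> ->; rewrite gerBl mulr_ge0 // invr_ge0 exprn_ge0.
have := mean_bucket_sum_pow m_gt0 (index_enum_uniq 'I_m) lam0 (leqnn q) HF.
have -> : size (index_enum 'I_m) = m.
  by rewrite -[index_enum _]filter_predT size_filter -sum1_count sum1_card card_ord.
set Y := mean _ => H.
have H2 : lam ^+ q / q`!%:R * Y <= 16 ^+ q.
  apply: (le_trans H).
  apply: (@le_trans _ _ (expR (2 * (L / m%:R)) ^+ m)).
    rewrite lerXn2r ?nnegrE ?expR_ge0 ?expR_ge1Dx //.
    by rewrite addr_ge0 // mulr_ge0 // ltW.
  rewrite -expRM_natl.
  have -> : m%:R * (2 * (L / m%:R)) = L * 2 by field; rewrite gt_eqF.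
  apply: (@le_trans _ _ (expR (q%:R * 2))).
    by rewrite ler_expR ler_pM2r.
  rewrite expRM_natl lerXn2r ?nnegrE ?expR_ge0 //.
  have -> : 2 = 1 + 1 :> R by ring.
  have e4 := expR1_le4 R; have := expR_ge0 (1 : R); rewrite expRD; nra.
have Y0 : 0 <= Y.
  apply: (@mean_cone_ge0 _ _ _ x finset.setT).
  apply: coneX; apply: cone_sum => b _.
  exact: coneS (finset.subsetT _) (cone_bucket x b).
have q0 : (0 : R) < q%:R by apply: lt_le_trans Lq.
have fq : (q`!%:R : R) <= q%:R ^+ q by rewrite -natrX ler_nat fact_le_expn.
have H3 : lam ^+ q * Y <= 16 ^+ q * q%:R ^+ q.
  move: H2; rewrite mulrAC ler_pdivrMr ?ltr0n ?fact_gt0 // => /le_trans; apply.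
  by rewrite ler_pM2l ?exprn_gt0.
rewrite -(ler_pM2l (exprn_gt0 q lam0)) (le_trans H3) // -!exprMn.
rewrite lerXn2r ?nnegrE ?mulr_ge0 ?divr_ge0 ?(ltW e0) ?(ltW lam0) //.
have -> : lam * (eps / (16 * 256)) = 16 * (2 * L).
  by rewrite lamE KE; field; rewrite gt_eqF.
by rewrite ler_pM2l.
Qed.

End Tail.

(** * A lattice net of the unit ball *)

Section Net.
Variables (R : realType) (r : nat).
Implicit Types (M : 'M[R]_r) (u v w : 'cV[R]_r).

Definition normsq u : R := \sum_i u i 0 ^+ 2.

Definition bilin M u v : R := (u^T *m M *m v) 0 0.

Lemma bilinDl M u v w : bilin M (u + v) w = bilin M u w + bilin M v w.
Proof. by rewrite /bilin linearD /= !mulmxDl mxE. Qed.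

Lemma bilinDr M u v w : bilin M w (u + v) = bilin M w u + bilin M w v.
Proof. by rewrite /bilin mulmxDr mxE. Qed.

Lemma bilinZl M (a : R) u w : bilin M (a *: u) w = a * bilin M u w.
Proof. by rewrite /bilin linearZ /= -!scalemxAl mxE. Qed.

Lemma bilinZr M (a : R) u w : bilin M w (a *: u) = a * bilin M w u.
Proof. by rewrite /bilin -scalemxAr mxE. Qed.

Lemma normsq_ge0 u : 0 <= normsq u.
Proof. by apply: sumr_ge0 => i _; apply: sqr_ge0. Qed.

Lemma normsqZ (a : R) u : normsq (a *: u) = a ^+ 2 * normsq u.
Proof.
by rewrite /normsq mulr_sumr; apply: eq_bigr => i _; rewrite mxE exprMn.
Qed.

Lemma normsq_parallelogram u v :
  normsq (u + v) + normsq (u - v) = 2 * (normsq u + normsq v).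
Proof.
rewrite /normsq -!big_split mulr_sumr; apply: eq_bigr => i _; rewrite !mxE /=.
by ring.
Qed.

Lemma normsq_eq0 u : normsq u = 0 -> u = 0.
Proof.
move=> /eqP; rewrite psumr_eq0 => [/allP u0|i _]; last exact: sqr_ge0.
apply/colP => i; rewrite !mxE; apply/eqP; rewrite -sqrf_eq0.
exact: u0 (mem_index_enum i).
Qed.

Definition grid_point (f : {ffun 'I_r -> 'I_(16 * r).+1 * bool}) : 'cV[R]_r :=
  \col_i ((-1) ^+ (f i).2 * ((f i).1)%:R / (4 * Num.sqrt r%:R)).

Definition grid : {set {ffun 'I_r -> 'I_(16 * r).+1 * bool}} :=
  [set f : {ffun 'I_r -> 'I_(16 * r).+1 * bool} |
    (\sum_i (f i).1 ^ 2 <= 16 * r)%N]%SET.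

Hypothesis r_gt0 : (0 < r)%N.

Let h : R := (4 * Num.sqrt r%:R)^-1.

Let h_gt0 : 0 < h.
Proof. by rewrite invr_gt0 mulr_gt0 // sqrtr_gt0 ltr0n. Qed.

Let h_sq : h ^+ 2 * (16 * r%:R) = 1.
Proof.
rewrite /h exprVn exprMn sqr_sqrtr ?ler0n // -natrX mulVf //.
by rewrite mulf_neq0 // pnatr_eq0 // -lt0n.
Qed.

Lemma normsq_grid f : f \in grid -> normsq (grid_point f) <= 1.
Proof.
rewrite finset.in_set => fg; rewrite -h_sq /normsq.
apply: (@le_trans _ _ (h ^+ 2 * (\sum_i (f i).1 ^ 2)%:R)).
  rewrite natr_sum mulr_sumr; apply: ler_sum => i _; rewrite mxE -/h.
  by rewrite !exprMn sqrr_sign mul1r mulrC natrX.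
by rewrite ler_wpM2l ?sqr_ge0 // -natrM ler_nat.
Qed.

Lemma grid_round v : normsq v <= 1 ->
  exists2 f, f \in grid & normsq (4 *: (v - grid_point f)) <= 1.
Proof.
move=> v1; pose z i := Num.truncn (`|v i 0| / h).
have zP i : (z i)%:R * h <= `|v i 0| /\ `|v i 0| < (z i)%:R * h + h.
  have /truncn_itv/andP[] : 0 <= `|v i 0| / h by rewrite divr_ge0 // ltW.
  rewrite ler_pdivlMr // ltr_pdivrMr // -/(z i) => -> .
  by rewrite -natr1 mulrDl mul1r => ->.
have zS : (\sum_i z i ^ 2 <= 16 * r)%N.
  rewrite -(ler_nat R) natr_sum -(ler_pM2l (exprn_gt0 2 h_gt0)) natrM h_sq.
  apply: le_trans v1; rewrite mulr_sumr; apply: ler_sum => i _.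
  have [zi _] := zP i; rewrite natrX -exprMn mulrC -(real_normK (num_real (v i 0))).
  by rewrite lerXn2r ?nnegrE // mulr_ge0 // ltW.
have zN i : (z i < (16 * r).+1)%N.
  rewrite ltnS (leq_trans _ zS) // (bigD1 i) //= (@leq_trans (z i ^ 2)) //.
    by case: (z i) => // k; rewrite -mulnn leq_pmulr.
  exact: leq_addr.
exists [ffun i => (inord (z i), v i 0 < 0)].
  rewrite finset.in_set; apply: leq_trans zS; apply: leq_sum => i _.
  by rewrite ffunE inordK.
rewrite normsqZ -[leRHS]h_sq mulrC.
have -> : 4 ^+ 2 = 16 :> R by ring.
rewrite [leRHS](_ : _ = r%:R * h ^+ 2 * 16); last by ring.
rewrite ler_pM2r //.
have -> : r%:R * h ^+ 2 = \sum_(i < r) h ^+ 2.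
  by rewrite sumr_const card_ord mulr_natl.
apply: ler_sum => i _; rewrite !mxE ffunE /= inordK // -/h.
have -> : v i 0 - (-1) ^+ (v i 0 < 0)%R * (z i)%:R * h =
          (-1) ^+ (v i 0 < 0)%R * (`|v i 0| - (z i)%:R * h).
  by rewrite mulrBr mulrA -numEsign.
rewrite exprMn sqrr_sign mul1r; have [z1 z2] := zP i.
rewrite lerXn2r ?nnegrE ?subr_ge0 ?(ltW h_gt0) //.
by rewrite lerBlDl ltW.
Qed.

Lemma card_grid : (#|grid|)%:R <= (4 * 2 ^+ 16) ^+ r :> R.
Proof.
rewrite -sum1_card natr_sum.
apply: (@le_trans _ _ (\sum_(f : {ffun 'I_r -> 'I_(16 * r).+1 * bool})
    \prod_i (2 ^+ 16 * 2 ^- (f i).1 : R))).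
  rewrite big_mkcond; apply: ler_sum => f _; case: ifPn => [|_]; last first.
    by apply: prodr_ge0 => i _; rewrite mulr_ge0 // ?invr_ge0 exprn_ge0.
  rewrite finset.in_set => fg.
  rewrite big_split prodr_const card_ord -exprM prodfV -expr_sum.
  rewrite ler_pdivlMr ?exprn_gt0 // mul1r ler_eXn2l ?ltr1n //.
  apply: leq_trans fg; apply: leq_sum => i _.
  by case: (nat_of_ord _) => // k; rewrite -mulnn leq_pmulr.
rewrite -(bigA_distr_bigA (fun (i : 'I_r) (c : 'I_(16 * r).+1 * bool) =>
  2 ^+ 16 * 2 ^- c.1 : R)) /= prodr_const card_ord.
rewrite lerXn2r ?nnegrE //.
  by apply: sumr_ge0 => i _; rewrite mulr_ge0 // ?invr_ge0 exprn_ge0.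
rewrite -(pair_bigA _ (fun (i : 'I_(16 * r).+1) (b : bool) => 2 ^+ 16 * 2 ^- i)) /=.
rewrite (eq_bigr (fun i : 'I_(16 * r).+1 => 2 * 2 ^+ 16 * 2 ^- i)); last first.
  by move=> i _; rewrite big_bool /=; ring.
rewrite -mulr_sumr.
have -> : \sum_(i < (16 * r).+1) 2 ^- i = 2 - 2 ^- (16 * r) :> R.
  elim: (16 * r)%N => [|p IH]; first by rewrite big_ord_recl big_ord0 expr0; field.
  by rewrite big_ord_recr /= IH exprS; field; rewrite expf_neq0.
have : 0 <= 2 ^- (16 * r) :> R by rewrite invr_ge0 exprn_ge0.
have : 0 <= 2 ^+ 16 :> R by rewrite exprn_ge0.
by nra.
Qed.

Lemma quadratic_net M (a : R) :
  (forall f, f \in grid -> `|bilin M (grid_point f) (grid_point f)| <= a) ->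
  forall v, `|bilin M v v| <= 4 * a * normsq v.
Proof.
move=> net.
have n01 : normsq (0 : 'cV[R]_r) <= 1.
  by rewrite /normsq big1 // => i _; rewrite mxE expr0n.
pose T := [set `|bilin M v v| | v in [set v | normsq v <= 1]]%classic.
have T0 : T !=set0.
  by exists `|bilin M 0 0|; exists 0.
have Tb : has_ubound T.
  exists (\sum_j \sum_i `|M i j|) => _ [v /= v1 <-].
  have vi i : `|v i 0| <= 1.
    rewrite -(@ler_pXn2r _ 2) ?nnegrE // expr1n real_normK ?num_real //.
    apply: le_trans v1; rewrite /normsq (bigD1 i) //= lerDl.
    by apply: sumr_ge0 => j _; apply: sqr_ge0.
  rewrite /bilin mxE; apply: le_trans (ler_norm_sum _ _ _) _.
  apply: ler_sum => j _; rewrite normrM mxE.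
  apply: (@le_trans _ _ (`|\sum_i v^T 0 i * M i j|)).
    by rewrite ler_piMr.
  apply: le_trans (ler_norm_sum _ _ _) _; apply: ler_sum => i _.
  by rewrite normrM mxE ler_piMl.
set s := sup T.
have sT v : normsq v <= 1 -> `|bilin M v v| <= s.
  by move=> v1; apply: ub_le_sup => //; exists v.
have sN v : `|bilin M v v| <= s * normsq v.
  have [v0|v0] := eqVneq (normsq v) 0.
    rewrite (normsq_eq0 v0) -[X in bilin M X](scale0r 0) bilinZl.
    rewrite mul0r normr0 mulr_ge0 ?normsq_ge0 //.
    exact: le_trans (normr_ge0 _) (sT 0 n01).
  have v1 : 0 < normsq v by rewrite lt_neqAle eq_sym v0 normsq_ge0.
  pose c := Num.sqrt (normsq v).
  have c0 : 0 < c by rewrite sqrtr_gt0.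
  have c2 : c ^+ 2 = normsq v by rewrite sqr_sqrtr // ltW.
  have := sT (c^-1 *: v); rewrite normsqZ exprVn c2 mulVf // lexx => /(_ isT).
  rewrite bilinZl bilinZr mulrA -expr2 exprVn c2 normrM gtr0_norm ?invr_gt0 //.
  by rewrite mulrC ler_pdivrMr.
(* Write v = w + u / 4 with w in the net and |u| <= 1, and polarize. *)
have sa : s <= a + 9 / 16 * s.
  apply: ge_sup => // _ [v /= v1 <-].
  have [f fg] := grid_round v1.
  have w1 := normsq_grid fg; have wa := net f fg.
  move: (grid_point f) w1 wa => w w1 wa.
  have n4 : 4 != 0 :> R by rewrite pnatr_eq0.
  have [u uE] : exists u, u = 4 *: (v - w) by exists (4 *: (v - w)).
  rewrite -uE => u1.
  have s0 : 0 <= s by apply: le_trans (sT v v1).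
  have -> : v = w + 4^-1 *: u.
    by rewrite uE scalerA mulVf // scale1r addrCA subrr addr0.
  have -> : bilin M (w + 4^-1 *: u) (w + 4^-1 *: u) = bilin M w w +
      (8^-1 * bilin M (w + u) (w + u) - 8^-1 * bilin M (w - u) (w - u) +
       16^-1 * bilin M u u).
    rewrite -[- u]scaleN1r !(bilinDl, bilinDr, bilinZl, bilinZr).
    by field.
  apply: le_trans (ler_normD _ _) _; apply: lerD; first exact: wa.
  apply: le_trans (ler_normD _ _) _.
  apply: (@le_trans _ _ (8^-1 * (s * normsq (w + u)) + 8^-1 * (s * normsq (w - u))
       + 16^-1 * (s * normsq u))).
    apply: lerD; last by rewrite normrM ger0_norm ?invr_ge0 // ler_wpM2l ?invr_ge0.
    apply: le_trans (ler_normB _ _) _; rewrite !normrM ger0_norm ?invr_ge0 //.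
    by apply: lerD; rewrite ler_wpM2l ?invr_ge0.
  rewrite -mulrDr -mulrDr normsq_parallelogram; nra.
have s4 : s <= 4 * a.
  by have := le_trans (normr_ge0 _) (sT 0 n01); lra.
by move=> v; apply: le_trans (sN v) _; rewrite ler_wpM2r ?normsq_ge0.
Qed.

End Net.

(** * From moments to the embedding probability *)

Lemma hashing_probability (R : realType) (disp : measure_display)
    (T : measurableType disp) (P : probability T R) (m n : nat)
    (X : 'I_n -> T -> 'I_m * bool) (G : {ffun 'I_n -> 'I_m * bool} -> Prop) :
  (forall j (B : set ('I_m * bool)), measurable (X j @^-1` B)) ->
  mutually_independent P X ->
  (forall j (i : 'I_m) (b : bool),
     P (X j @^-1` [set (i, b)]) = (m%:R^-1 * 2^-1)%:E) ->
  P [set t | G [ffun j => X j t]] = (mean (fun w => (`[< G w >])%:R))%:E.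
Proof.
move=> mX iX pX.
pose cell (w : {ffun 'I_n -> 'I_m * bool}) :=
  \bigcap_(j in [set` finset.setT]) X j @^-1` [set w j].
have cellE w t : cell w t <-> [ffun j => X j t] = w.
  split=> [H|<- j _]; last by rewrite /= ffunE.
  by apply/ffunP => j; rewrite ffunE; apply: (H j); rewrite /= finset.in_setT.
have mcell w : measurable (cell w).
  by apply: fin_bigcap_measurable => // j _; apply: mX.
have pcell w : P (cell w) = ((m%:R^-1 * 2^-1) ^+ n)%:E.
  rewrite /cell (iX finset.setT (fun j => [set w j])).
  rewrite (eq_bigr (fun=> (m%:R^-1 * 2^-1 : R)%:E)); last first.
    by move=> j _; case: (w j) => i b; rewrite -(pX j i b).
  by rewrite prodEFin prodr_const finset.cardsT card_ord.
have -> : [set t | G [ffun j => X j t]] = \bigcup_(w in [set w | G w]) cell w.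
  apply/seteqP; split=> [t /= Gt|t [w /= Gw /cellE tw]]; last by rewrite /= tw.
  by exists [ffun j => X j t] => //; apply/cellE.
rewrite measure_fin_bigcup //; [|exact: finite_finset|]; last first.
  apply/classical_sets.trivIsetP => w w' _ _ ww'.
  apply/seteqP; split=> // t [/cellE e /cellE e'].
  by move: ww'; rewrite -e -e' eqxx.
have -> : [set w | G w] = [set` [pred w | `[< G w >]]].
  by apply/seteqP; split=> w /asboolP.
transitivity (\sum_(w <- index_enum {ffun 'I_n -> 'I_m * bool} | `[< G w >])
    P (cell w))%E.
  symmetry; apply: bigfs; first exact: index_enum_uniq.
  by move=> w _; rewrite mem_index_enum.
rewrite /mean -sumEFin big_mkcond; apply: eq_bigr => w _ /=.
by case: ifP => Gw; rewrite ?pcell ?mulr1 ?mulr0.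
Qed.

Lemma mulmx_hashing (R : realType) (m n : nat) (w : 'I_n -> 'I_m * bool)
    (y : 'cV[R]_n) (b : 'I_m) :
  (hashing_of R w *m y) b 0 = \sum_j entry b (y j 0) (w j).
Proof.
rewrite mxE; apply: eq_bigr => j _; rewrite mxE /entry.
by case: eqP => _; rewrite ?mul0r // mulrC.
Qed.

Lemma normsq_hashing (R : realType) (m n : nat)
    (w : {ffun 'I_n -> 'I_m * bool}) (y : 'cV[R]_n) :
  normsq (hashing_of R w *m y) =
  normsq y + \sum_(b < m) bucket (fun j => y j 0) b w.
Proof.
rewrite /normsq.
have -> : \sum_(b < m) bucket (fun j => y j 0) b w =
   \sum_(b < m) (\sum_j entry b (y j 0) (w j)) ^+ 2 - \sum_i y i 0 ^+ 2.
  under eq_bigr do rewrite bucketE.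
  rewrite sumrB exchange_big /=; congr (_ - _); apply: eq_bigr => j _.
  rewrite (bigD1 (w j).1) //= big1 => [|b /negPf bw]; last first.
    by rewrite /entry bw expr0n.
  by rewrite /entry eqxx addr0 exprMn sqrr_sign mulr1.
by rewrite addrC subrK; apply: eq_bigr => b _; rewrite mulmx_hashing.
Qed.

Lemma normsqE (R : realType) (n : nat) (y : 'cV[R]_n) :
  normsq y = (y^T *m y) 0 0.
Proof. by rewrite mxE; apply: eq_bigr => i _; rewrite mxE expr2. Qed.

Lemma norm2_sq (R : realType) (n : nat) (y : 'cV[R]_n) :
  norm2 y ^+ 2 = normsq y.
Proof. by rewrite sqr_sqrtr // normsq_ge0. Qed.

Lemma cauchy_schwarz (R : realType) (I : finType) (a b : I -> R) :
  (\sum_i a i * b i) ^+ 2 <= (\sum_i a i ^+ 2) * (\sum_i b i ^+ 2).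
Proof.
have : 0 <= \sum_i \sum_j (a i * b j - a j * b i) ^+ 2.
  by apply: sumr_ge0 => i _; apply: sumr_ge0 => j _; apply: sqr_ge0.
suff -> : \sum_i \sum_j (a i * b j - a j * b i) ^+ 2 =
    2 * ((\sum_i a i ^+ 2) * (\sum_i b i ^+ 2) - (\sum_i a i * b i) ^+ 2).
  by rewrite pmulr_rge0 // subr_ge0.
have e1 : (\sum_i a i ^+ 2) * (\sum_i b i ^+ 2) =
    \sum_i \sum_j a i ^+ 2 * b j ^+ 2.
  by rewrite mulr_suml; apply: eq_bigr => i _; rewrite mulr_sumr.
have e2 : (\sum_i a i * b i) ^+ 2 = \sum_i \sum_j (a i * b i) * (a j * b j).
  by rewrite expr2 mulr_suml; apply: eq_bigr => i _; rewrite mulr_sumr.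
have e3 : (\sum_i a i ^+ 2) * (\sum_i b i ^+ 2) =
    \sum_i \sum_j a j ^+ 2 * b i ^+ 2 by rewrite e1 exchange_big.
transitivity (\sum_i (\sum_j a i ^+ 2 * b j ^+ 2 + \sum_j a j ^+ 2 * b i ^+ 2
    - 2 * \sum_j (a i * b i) * (a j * b j))).
  apply: eq_bigr => i _; rewrite mulr_sumr -big_split -sumrB.
  by apply: eq_bigr => j _ /=; ring.
by rewrite sumrB big_split -mulr_sumr /= -e1 -e2 -e3; ring.
Qed.

Lemma coherence_entry_le (R : realType) (n r : nat) (U : 'M[R]_(n, r))
    (w : 'cV[R]_r) (j : 'I_n) :
  normsq w <= 1 -> `|(U *m w) j 0| <= max_row_norm U.
Proof.
move=> w1; rewrite /max_row_norm.
apply: (@le_trans _ _ (norm2 (row j U)^T)); last first.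
  exact: (le_bigmax_cond 0 (fun i => norm2 (row i U)^T)).
rewrite -(@ler_pXn2r _ 2) ?nnegrE ?sqrtr_ge0 // real_normK ?num_real //.
rewrite norm2_sq mxE; apply: le_trans (cauchy_schwarz _ _) _.
have -> : normsq (row j U)^T = \sum_i U j i ^+ 2.
  by apply: eq_bigr => i _; rewrite !mxE.
by rewrite ler_piMr // sumr_ge0 // => i _; apply: sqr_ge0.
Qed.

Section Embedding.
Variables (R : realType) (m n d r : nat) (A : 'M[R]_(n, d)).
Variables (U : 'M[R]_(n, r)) (s : 'rV[R]_r) (V : 'M[R]_(d, r)) (eps : R).
Hypothesis svd : compact_svd A U s V.
Hypothesis r_gt0 : (0 < r)%N.

Lemma normsq_isometry (y : 'cV[R]_r) : normsq (U *m y) = normsq y.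
Proof.
have [UU _ _ _] := svd.
by rewrite !normsqE trmx_mul mulmxA -(mulmxA _ U^T) UU mulmx1.
Qed.

Lemma subspace_embedding_net (w : {ffun 'I_n -> 'I_m * bool}) :
  (forall f, f \in grid r ->
     `|\sum_(b < m) bucket (fun j => (U *m grid_point R f) j 0) b w|
       <= eps / 4) ->
  subspace_embedding eps A (hashing_of R w).
Proof.
move=> net x; have [UU _ _ AE] := svd.
pose S := hashing_of R w.
pose M := U^T *m S^T *m S *m U - 1%:M.
have ME y : bilin M y y = \sum_(b < m) bucket (fun j => (U *m y) j 0) b w.
  apply/eqP; rewrite -subr_eq0; apply/eqP.
  have := normsq_hashing w (U *m y).
  rewrite normsq_isometry normsqE [normsq y]normsqE => H.
  have -> : bilin M y y =
      ((S *m (U *m y))^T *m (S *m (U *m y))) 0 0 - (y^T *m y) 0 0.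
    have B00 (B C : 'M[R]_1) : (B - C) 0 0 = B 0 0 - C 0 0 by rewrite !mxE.
    by rewrite /bilin /M mulmxBr mulmxBl mulmx1 B00 !trmx_mul !mulmxA.
  by rewrite H; ring.
pose y := diag_mx s *m V^T *m x.
have Ax : A *m x = U *m y by rewrite AE /y !mulmxA.
have Q := @quadratic_net _ _ r_gt0 M (eps / 4) _ y.
rewrite -mulmxA Ax !norm2_sq normsq_hashing normsq_isometry -ME.
have {Q} : `|bilin M y y| <= eps * normsq y.
  have -> : eps = 4 * (eps / 4) by field.
  by apply: Q => f fg; rewrite ME; apply: net.
rewrite ler_norml => /andP[Q1 Q2]; split; lra.
Qed.

Lemma mean_embedding_ge (q : nat) (a : R) : (0 < m)%N -> ~~ odd q -> 0 < eps ->
  (forall f, f \in grid r -> mean (fun w : {ffun 'I_n -> 'I_m * bool} =>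
    (\sum_(b < m) bucket (fun j => (U *m grid_point R f) j 0) b w) ^+ q)
     <= (a * (eps / 4)) ^+ q) ->
  1 - (4 * 2 ^+ 16) ^+ r * a ^+ q <=
  mean (fun w : {ffun 'I_n -> 'I_m * bool} =>
    (`[< subspace_embedding eps A (hashing_of R w) >])%:R).
Proof.
move=> m0 oq e0 H.
pose Y f w := \sum_(b < m) bucket (fun j => (U *m grid_point R f) j 0) b w.
apply: (@le_trans _ _ (mean (fun w : {ffun 'I_n -> 'I_m * bool} =>
   1 - \sum_(f in grid r) (4 / eps) ^+ q * Y f w ^+ q))).
  rewrite meanB mean_cst // lerD2l lerN2 mean_sum.
  apply: (@le_trans _ _ (\sum_(f in grid r) a ^+ q)).
    apply: ler_sum => f fg; rewrite meanZ.
    apply: ler_trans_eq (ler_wpM2l _ (H f fg)) erefl _.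
      by rewrite exprn_even_ge0.
    by rewrite -exprMn; congr (_ ^+ _); field; rewrite gt_eqF.
  rewrite sumr_const -[leLHS]mulr_natl ler_wpM2r ?exprn_even_ge0 //.
  exact: card_grid.
apply: ler_mean => w; case: asboolP => [_|bad].
  rewrite /= gerBl sumr_ge0 // => f _.
  by rewrite mulr_ge0 ?exprn_even_ge0.
rewrite /= subr_le0.
have [f fg fY] : exists2 f, f \in grid r & eps / 4 < `|Y f w|.
  apply: contra_notP bad => nf; apply: subspace_embedding_net => f fg.
  by rewrite leNgt; apply/negP => fY; apply: nf; exists f.
rewrite (bigD1 f) //= -[leLHS]addr0 lerD //; last first.
  by apply: sumr_ge0 => g _; rewrite mulr_ge0 ?exprn_even_ge0.
rewrite -exprMn.
have -> : (4 / eps * Y f w) ^+ q = (4 / eps * `|Y f w|) ^+ q.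
  rewrite !exprMn; congr (_ * _).
  by rewrite -[LHS]ger0_norm ?exprn_even_ge0 // normrX.
apply: exprn_ege1; rewrite -ler_pdivrMl ?divr_gt0 // mulr1 invf_div.
exact: ltW.
Qed.

End Embedding.

Theorem theorem2p3p1 (R : realType) :
  exists C C1 C2 : R, [/\ 0 < C, 0 < C1 & 0 < C2] /\
  forall (eps delta E : R) (r d n m : nat),
    0 < eps < 1 -> 0 < delta < 1 ->
    (0 < r)%N -> (r <= d)%N -> (d <= n)%N -> (0 < m)%N -> (m <= n)%N ->
    0 < E ->
    C <= E ->
    E <= 2 * expR (4 * r%:R) / ((4 * r%:R + ln delta^-1) * delta) ->
    E * C2 ^- 2 * eps ^- 2 * (4 * r%:R + ln delta^-1) <= m%:R ->
    forall (A : 'M[R]_(n, d)) (mu : R),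
      \rank A = r -> is_coherence A mu ->
      mu <= mu_bar C1 C2 E r eps delta ->
      forall (disp : measure_display) (T : measurableType disp)
             (P : probability T R) (S : T -> 'M[R]_(m, n)),
        hashing_matrix P S ->
        ((1 - delta)%:E <= P [set t | subspace_embedding eps A (S t)])%E.
Proof.
pose K : R := 256 * (2 * 256); pose C2 : R := (128 * K)^-1.
have C20 : 0 < C2 by rewrite invr_gt0 /K; lra.
exists 1, 2^-1, C2; split; first by split=> //; rewrite invr_gt0.
move=> eps delta E r d n m eps01 /andP[d0 d1] r0 _ _ m0 _ _ E1 _ mE A mu rkA.
have [e0 e1] := andP eps01.
move=> [U [s [V [svd ->]]]]; move: U s V svd; rewrite rkA => U s V svd muU.
move=> disp T P S [X [mX iX pX SE]].
set L := 4 * r%:R + ln delta^-1 in mE.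
have lnd : 0 < ln delta^-1 by rewrite ln_gt0 // invf_gt1.
have L4 : 4 < L.
  have : (1 : R) <= r%:R by rewrite ler1n.
  by rewrite /L; lra.
have L0 : 0 < L by lra.
have [q [oq Lq qL]] : exists q : nat, [/\ ~~ odd q, L <= q%:R & q%:R <= 2 * L].
  have /andP[t1 t2] := truncn_itv (ltW L0 : 0 <= L).
  set t := Num.truncn L in t1 t2; rewrite -natr1 in t2.
  have [ot|ot] := boolP (odd t).
    by exists t.+1; rewrite /= ot -natr1; split=> //; lra.
  by exists t.+2; rewrite /= ot -!natr1; split=> //; lra.
pose nu := mu_bar 2^-1 C2 E r eps delta.
have nuE : nu = 2^-1 * Num.sqrt C2 * Num.sqrt eps *
  Num.min (ln (E / (C2 * eps)) / L) (Num.sqrt (ln E / L)) by [].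
have nu0 : 0 <= nu.
  apply: le_trans muU; rewrite /max_row_norm.
  by apply: (big_ind (fun x : R => 0 <= x)) => // [x y x0 y0|i _];
     rewrite ?le_max ?x0 ?sqrtr_ge0.
have s0 : 0 <= 2^-1 * Num.sqrt C2 * Num.sqrt eps.
  by rewrite !mulr_ge0 ?invr_ge0 ?sqrtr_ge0.
have s2 : (2^-1 * Num.sqrt C2 * Num.sqrt eps) ^+ 2 = C2 * eps / 4.
  by rewrite !exprMn !sqr_sqrtr ?(ltW C20) ?(ltW e0) //; field.
have le_sq (b : R) : Num.min (ln (E / (C2 * eps)) / L) (Num.sqrt (ln E / L)) <= b ->
    nu ^+ 2 <= C2 * eps / 4 * b ^+ 2.
  move=> minb; rewrite -s2 -exprMn.
  have nub : nu <= 2^-1 * Num.sqrt C2 * Num.sqrt eps * b.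
    by rewrite nuE ler_wpM2l.
  by rewrite lerXn2r // nnegrE // (le_trans nu0).
have nu1 : nu ^+ 2 <= C2 * eps / 4 * (ln E / L).
  have := le_sq (Num.sqrt (ln E / L)); rewrite sqr_sqrtr.
    by apply; rewrite ge_min lexx orbT.
  by rewrite divr_ge0 ?ln_ge0 // ltW.
have nu2 : nu ^+ 2 <= C2 * eps / 4 * (ln (E / (C2 * eps)) / L) ^+ 2.
  by apply: le_sq; rewrite ge_min lexx.
have -> : [set t | subspace_embedding eps A (S t)] =
    [set t | subspace_embedding eps A (hashing_of R [ffun j => X j t])].
  apply/seteqP; split=> t /=; rewrite SE; congr (subspace_embedding _ _ _);
    by apply/matrixP => i j; rewrite !mxE ffunE.
rewrite (hashing_probability
  (fun w => subspace_embedding eps A (hashing_of R w)) mX iX pX) lee_fin.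
have n1024 : (0 : R) < 4 * 256 by lra.
apply: le_trans (mean_embedding_ge svd r0 (q := q) (a := (4 * 256)^-1) m0 oq e0 _).
  rewrite lerD2l lerN2 exprVn ler_pdivrMr ?exprn_gt0 //.
  have e4 : expR (5 * L) <= (4 * 256) ^+ q.
    apply: (@le_trans _ _ (expR (q%:R * 5))).
      by rewrite ler_expR mulrC ler_pM2r.
    rewrite expRM_natl lerXn2r ?nnegrE ?expR_ge0 ?(ltW n1024) //.
    rewrite -[5%:R]mulr1 expRM_natl.
    apply: le_trans (_ : 4 ^+ 5 <= _); last by lra.
    by rewrite lerXn2r ?nnegrE ?expR_ge0 ?expR1_le4.
  rewrite -ler_pdivrMl //; apply: le_trans e4.
  have e2 : 2 <= expR 1 :> R by have := expR_ge1Dx (1 : R); lra.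
  have -> : 4 * 2 ^+ 16 = 2 ^+ 18 :> R.
    by rewrite [RHS](exprD 2 2 16); congr (_ * _); ring.
  rewrite -exprM mulrC.
  have -> : expR (5 * L) = expR (20 * r%:R + 5 * ln delta^-1).
    by congr expR; rewrite /L; ring.
  rewrite expRD; apply: ler_pM; rewrite ?invr_ge0 ?exprn_ge0 ?(ltW d0) //.
    apply: (@le_trans _ _ (expR 1 ^+ (20 * r))).
      apply: (@le_trans _ _ (2 ^+ (20 * r))).
        by rewrite ler_eXn2l ?ltr1n // leq_mul2r orbT.
      by rewrite lerXn2r ?nnegrE ?expR_ge0.
    by rewrite -expRM_natl natrM mulr1.
  rewrite -[leLHS]lnK ?posrE ?invr_gt0 // ler_expR; lra.
move=> f fg.
have := @mean_bucket_sum_le R m n (fun j => (U *m grid_point R f) j 0)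
  K C2 eps E L nu q m0 erefl erefl eps01 E1 L0 Lq qL mE nu0 nu1 nu2 _ _ _ erefl.
have -> : eps / (16 * 256) = (4 * 256)^-1 * (eps / 4) by field.
apply.
  move=> j; apply: le_trans muU; apply: coherence_entry_le.
  exact: normsq_grid r0 _ fg.
have := normsq_grid R r0 fg; rewrite -(normsq_isometry svd).
by [].
Qed.
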